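(* Let $t_g$ be a gauged stable ribbon tree of arity $n\geqslant 2$ with orientation $\omega$, whose gauge intersects exactly $j$ vertices $v_1,\dots,v_j$, ordered from left to right. Consider a codimension one (gauge-vertex) boundary component of $\overline{\mathcal{CT}}_n(t_g)$, in which the gauge comes to cross exactly one additional vertex $v$ of $t$, located between the $k$-th and $(k+1)$-th intersections of $t_g$, and let $t_g^0$ be the resulting gauged tree (so its vertices on the gauge are $v_1,\dots,v_k,v,v_{k+1},\dots,v_j$). Suppose the crossing results from a move in which $v$ is below the gauge in $t_g$ (i.e. $-\lambda>d(r,v)$) and on the gauge in $t^0_g$. Then the boundary component $\mathcal{CT}_n(t^0_g,\omega)$ has sign $(-1)^{j+k}$ in the boundary of $\overline{\mathcal{CT}}_n(t_g,\omega)$.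
   Context: A ribbon tree is a planar rooted tree with one outgoing external edge, whose adjacent vertex is the root $r$, and $n$ incoming external edges ordered from left to right; it is stable if all vertices are at least trivalent. $E(t)$ is its set of internal edges, $e(t)=|E(t)|$. An orientation of $t$ is an ordering of $E(t)$ up to even permutation. A gauged stable ribbon tree $t_g$ is a stable ribbon tree $t$ with a partition of its vertices into vertices below the gauge (between gauge and outgoing edge), on the gauge (intersected by it), and above the gauge, such that the parent (next vertex towards $r$) of any vertex below or on the gauge is below the gauge. $\mathcal{CT}_n(t_g)$ is the polyhedral cone of $(\lambda,(l_e)_{e\in E(t)})\in\mathbb R\times\,]0,+\infty[^{e(t)}$ with $-\lambda>d(r,v)$ for $v$ below, $-\lambda=d(r,v)$ for $v$ on, $-\lambda<d(r,v)$ for $v$ above the gauge ($d(r,v)$ = sum of the lengths on the path from $r$ to $v$). It has dimension $e(t)+1-j$ if $j$ vertices are on the gauge. An orientation $\omega$ of $t$ orients it, giving $\mathcal{CT}_n(t_g,\omega)$: if $j=0$, as an open subset of $\mathbb R\times\,]0,+\infty[^{e(t)}$ (coordinate $\lambda$ first, then the lengths ordered by $\omega$); in general, with $v_1,\dots,v_j$ the vertices on the gauge from left to right and $\nu_k$ a vector outward-pointing for the half-space $-\lambda\geqslant d(r,v_k)$ (e.g. the gradient of $\lambda+d(r,v_k)$), it is cooriented by $(\nu_1,\dots,\nu_j)$, i.e. a basis of its tangent space is positive iff its concatenation after $(\nu_1,\dots,\nu_j)$ is positive. $\overline{\mathcal{CT}}_n(t_g)$ is the compactification of $\mathcal{CT}_n(t_g)$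 by limits of metric gauged trees (edges may collapse or break, the gauge may reach vertices). The (gauge-vertex) boundary consists of the codimension one strata $\mathcal{CT}_n(t_g^0)$ with the same underlying tree $t$ where exactly one inequality for a vertex $v$ has become an equality $-\lambda=d(r,v)$. A codimension one stratum with a given orientation has sign $\varepsilon$ in the boundary if the boundary orientation (outward-pointing vector first) is $\varepsilon$ times the given one. *)

(* Defs.v *)
From HB Require Import structures.
From mathcomp Require Import all_boot all_order all_fingroup all_algebra.
From mathcomp Require Import all_classical all_reals all_analysis.

Set Implicit Arguments.
Unset Strict Implicit.
Unset Printing Implicit Defensive.

Import Order.TTheory GRing.Theory Num.Theory.
Import numFieldNormedType.Exports.

Local Open Scope classical_set_scope.
Local Open Scope ring_scope.

(* A planar rooted tree.  [Leaf] is an incoming external edge, [Vertex ts] a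
   vertex whose incoming edges carry, from left to right, the trees [ts].  A
   tree [Vertex _] has a root vertex, to which the outgoing edge is attached. *)
Inductive tree := Leaf | Vertex of seq tree.

Fixpoint arity (t : tree) : nat :=
  if t is Vertex ts then sumn (map arity ts) else 1.

Fixpoint stable (t : tree) : bool :=
  if t is Vertex ts then (1 < size ts)%N && all stable ts else true.

(* A vertex is given by its address: the list of child positions, counted from
   the left, on the path going up from the root. *)
Fixpoint addresses (t : tree) : seq (seq nat) :=
  if t is Vertex ts then
    [::] :: flatten [seq map (cons ia.1) ia.2
                    | ia <- zip (iota 0 (size ts)) (map addresses ts)]
  else [::].

Definition vertex (t : tree) : finType := seq_sub (addresses t).

(* An internal edge is identified with the address of its upper vertex, so
   that internal edges correspond to the vertices other than the root. *)
Definition edge (t : tree) : finType :=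
  seq_sub [seq a <- addresses t | a != [::]].

Definition parent (t : tree) (u v : vertex t) : Prop :=
  exists i, val v = rcons (val u) i.

(* Lexicographic comparison of addresses.  On vertices none of which lies on
   the path from the root to another, this is the order from left to right. *)
Definition left_to_right (t : tree) : rel (vertex t) :=
  fun u v => ((val u : seqlexi nat) <= (val v : seqlexi nat))%O.

Definition ordering (t : tree) : finType :=
  {o : {ffun 'I_#|edge t| -> edge t} | injectiveb o}.

Definition same_orientation (t : tree) (o o' : ordering t) : bool :=
  [exists s : 'S_#|edge t|,
     ~~ odd_perm s && [forall i, val o' i == val o (s i)]].

(* An orientation is a class of orderings up to even permutation. *)
Record orientation (t : tree) := Orientation {
  orderings : {set ordering t};
  orderingsP :
    exists o, orderings = [set o' | same_orientation o o']%SET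
}.

Variant position := Below | On | Above.

Lemma position_dec : comparable position.
Proof. by rewrite /comparable /decidable; decide equality. Defined.

HB.instance Definition _ := hasDecEq.Build position (compareP position_dec).

Record gauged (t : tree) := Gauged {
  gauge_position :> vertex t -> position;
  gauge_positionP : forall u v,
    parent u v -> gauge_position v != Above -> gauge_position u = Below
}.

Definition gauge_vertices (t : tree) (g : gauged t) : seq (vertex t) :=
  sort (@left_to_right t) (enum [pred v | g v == On]).

(* Pairs (lambda, (l_e)_e). *)
Notation ambient R t := (R^o * {ffun edge t -> R^o})%type.

Definition dist (R : realType) (t : tree) (x : ambient R t) (v : vertex t) : R :=
  \sum_(e : edge t | prefix (val e) (val v)) x.2 e.

Definition cell (R : realType) (t : tree) (g : gauged t) : set (ambient R t) :=
  [set x : ambient R t | (forall e, 0 < x.2 e) /\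
     forall v, match g v return Prop with
               | Below => - x.1 > dist x v
               | On    => - x.1 = dist x v
               | Above => - x.1 < dist x v
               end].

Definition gauge_gap (R : realType) (t : tree) (v : vertex t)
  (x : ambient R t) : R^o := x.1 + dist x v.

Fact gauge_gap_is_linear (R : realType) (t : tree) (v : vertex t) :
  linear (@gauge_gap R t v).
Proof.
move=> a x y; rewrite /gauge_gap /dist /= scalerDr addrACA; congr (_ + _).
by rewrite scaler_sumr -big_split; apply: eq_bigr => e _; rewrite !ffunE.
Qed.

HB.instance Definition _ (R : realType) (t : tree) (v : vertex t) :=
  GRing.isLinear.Build R (ambient R t) R^o _ (@gauge_gap R t v)
    (@gauge_gap_is_linear R t v).

(* The cell is open in the linear subspace cut out by its equalities; this
   subspace is its tangent space at every point, and also the tangent space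
   of its compactification at the points of gauge-vertex strata. *)
Definition tangent (R : realType) (t : tree) (g : gauged t) :
    {vspace ambient R t} :=
  (\bigcap_(v | g v == On) lker (linfun (@gauge_gap R t v)))%VS.

(* The gradient of lambda + d(r, v), which points out of the half-space
   - lambda >= d(r, v). *)
Definition gradient (R : realType) (t : tree) (v : vertex t) : ambient R t :=
  (1, [ffun e : edge t => (prefix (val e) (val v))%:R]).

Definition coordinates (R : realType) (t : tree) (o : ordering t)
    (x : ambient R t) : 'rV[R]_(1 + #|edge t|) :=
  row_mx (x.1%:M : 'rV[R]_1) (\row_i x.2 (val o i)).

Definition ordered_det (R : realType) (t : tree) (o : ordering t)
    (s : seq (ambient R t)) : R :=
  \det (\matrix_(i < 1 + #|edge t|) coordinates o s`_i).

Definition positive_basis (R : realType) (t : tree) (g : gauged t)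
    (omega : orientation t) (b : seq (ambient R t)) : bool :=
  basis_of (tangent R g) b &&
  [exists o in orderings omega,
     0 < ordered_det o ([seq gradient R v | v <- gauge_vertices g] ++ b)].

(* The orientation of the cell, as a function on bases with values in {1, -1}. *)
Definition orientation_sign (R : realType) (t : tree) (g : gauged t)
    (omega : orientation t) (b : seq (ambient R t)) : int :=
  if positive_basis g omega b then 1 else -1.

(* A metric gauged tree is recorded by its edge lengths and by the positions of
   its vertices relative to the gauge, in extended reals.  In a limit, an edge
   of length 0 has collapsed and one of length +oo has broken; after breaking,
   the values lambda + d(r, v) give the position of the gauge in each piece:
   finite on the pieces crossed at finite distance, and constantly -oo or +oo
   on those entirely below or above it. *)
Definition embed (R : realType) (t : tree) (x : ambient R t) :
    prod_topology (fun _ : edge t + vertex t => \bar R) :=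
  fun c => match c with
           | inl e => (x.2 e)%:E
           | inr v => (gauge_gap v x)%:E
           end.

Definition compactification (R : realType) (t : tree) (g : gauged t) :
    set (prod_topology (fun _ : edge t + vertex t => \bar R)) :=
  closure (@embed R t @` cell g).

Definition outward_pointing (R : realType) (t : tree) (g : gauged t)
    (x w : ambient R t) : Prop :=
  w \in tangent R g /\
  \forall s \near (0 : R)^'+,
    compactification g (embed (x - s *: w)) /\
    ~ compactification g (embed (x + s *: w)).

(* [g0] arises from [g] by turning exactly one inequality, that of [v], into an
   equality: the cell of [g0] is a codimension one gauge-vertex stratum. *)
Definition gauge_vertex_stratum (t : tree) (g g0 : gauged t) (v : vertex t) :
    Prop :=
  [/\ g v != On, g0 v = On & forall u, u != v -> g0 u = g u].

(* The boundary orientation (outward-pointing vector first) of the cell of [g0]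
   is [eps] times its own orientation. *)
Definition sign_in_boundary (R : realType) (t : tree) (g g0 : gauged t)
    (omega : orientation t) (eps : int) : Prop :=
  forall x : ambient R t, cell g0 x ->
    (exists w, outward_pointing g x w) /\
    forall w b, outward_pointing g x w -> basis_of (tangent R g0) b ->
      orientation_sign g omega (w :: b) = eps * orientation_sign g0 omega b.

(* Main.v *)
(* At a point of the stratum, a vector w tangent to the cell of t_g points
   outward exactly when lambda + d(r, v) increases along w.  Let G be the list
   of gradients of the vertices on the gauge of t_g, G_v the gradient of v, and
   b a basis of the tangent space of the stratum.  Since gradients are
   orthogonal to the corresponding tangent spaces, (G, G_v, b) is a basis of the
   ambient space, and the coefficient of w along G_v in it is positive.  Hence
   det(G, w, b) is a positive multiple of det(G, G_v, b), which becomes the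
   determinant defining the orientation of the stratum once G_v has moved left
   past the j - k gradients of v_{k+1}, ..., v_j. *)
From HB Require Import structures.
Require Import Defs.
From mathcomp Require Import all_boot all_order all_fingroup all_algebra.
From mathcomp Require Import all_classical all_reals all_analysis.
From mathcomp Require Import lra.

Set Implicit Arguments.
Unset Strict Implicit.
Unset Printing Implicit Defensive.

Import Order.TTheory GRing.Theory Num.Theory.
Import numFieldNormedType.Exports.

Local Open Scope ring_scope.

(** * Ambient and tangent spaces *)

Lemma dim_ambient (R : realType) (t : tree) :
  \dim {: ambient R t} = (1 + #|edge t|)%N.
Proof.
rewrite dimvf; transitivity (1 + #|edge t| * 1)%N; first by [].
by rewrite muln1.
Qed.

Lemma tangentP (R : realType) (t : tree) (g : gauged t) (x : ambient R t) :
  reflect (forall v, g v == On -> gauge_gap v x = 0) (x \in tangent R g).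
Proof.
rewrite memvE; apply: (iffP subv_bigcapP) => tx v gv.
  by have := tx v gv; rewrite -memvE memv_ker lfunE => /eqP.
by rewrite -memvE memv_ker lfunE /= tx.
Qed.

(** * Addresses, and vertices on the gauge *)

Lemma mem_addresses_cons (ts : seq tree) (k : nat) (a : seq nat) :
  (k :: a \in addresses (Vertex ts)) = (a \in addresses (nth Leaf ts k)).
Proof.
rewrite [addresses _]/= inE /=; apply/flatten_mapP/idP => [[[i b]] | ak].
  case/(nthP (0%N, [::])) => m.
  rewrite size_zip size_iota size_map minnn => mts.
  rewrite nth_zip ?size_iota ?size_map// nth_iota// add0n (nth_map Leaf)//.
  by case=> <- <- /mapP[c ac [-> ->]].
(* Past the end of [ts] the default value of [nth] is [Leaf], which has no addresses. *)
have kts : (k < size ts)%N.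
  by rewrite ltnNge; apply/negP => tsk; rewrite (nth_default _ tsk) in ak.
exists (k, addresses (nth Leaf ts k)); last by apply/mapP; exists a.
apply/(nthP (0%N, [::])); exists k.
  by rewrite size_zip size_iota size_map minnn.
by rewrite nth_zip ?size_iota ?size_map// nth_iota// (nth_map Leaf).
Qed.

Lemma addresses_prefix (t : tree) (a b : seq nat) :
  prefix a b -> b \in addresses t -> a \in addresses t.
Proof.
elim: a b t => [|k a IH] [|l b] [|ts]//.
rewrite prefix_cons !mem_addresses_cons => /andP[/eqP<-]; exact: IH.
Qed.

(** Induction down the path from [v] to [u]: each parent met is below the gauge, hence not above it,
    so the gauge condition applies again. *)
Lemma gauge_below_prefix (t : tree) (g : gauged t) (u v : vertex t) :
  prefix (val u) (val v) -> u != v -> g v != Above -> g u = Below.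
Proof.
case/prefixP => s; elim/last_ind: s v => [|s i IH] v.
  by rewrite cats0 => /val_inj ->; rewrite eqxx.
rewrite -rcons_cat => vE uv gv.
have aw : val u ++ s \in addresses t.
  by apply: addresses_prefix (valP v); rewrite vE prefix_rcons.
pose w : vertex t := SeqSub aw.
have gw : g w = Below by apply: gauge_positionP gv; exists i.
have [<-//|uw] := eqVneq w u.
by apply: (IH w) => //; rewrite 1?eq_sym// gw.
Qed.

(** The unit vector of the edge just below [v]; the root has no such internal edge, and the
    direction of lambda takes its place. On the vertices of a gauge these vectors are dual to the
    forms [gauge_gap]. *)
Definition dual_vector (R : realType) (t : tree) (v : vertex t) : ambient R t :=
  if val v is [::] then (1, 0)
  else (0, [ffun e : edge t => (val e == val v)%:R]).

(* No vertex on the gauge lies below another one. *)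
Lemma gauge_gap_dual (R : realType) (t : tree) (g : gauged t) (u v : vertex t) :
  g u == On -> g v == On -> gauge_gap u (dual_vector R v) = (u == v)%:R.
Proof.
move=> /eqP gu /eqP gv.
have not_prefix : u != v -> ~~ prefix (val v) (val u).
  move=> uv; apply/negP => vu.
  have := gauge_below_prefix (g := g) vu; rewrite eq_sym uv gu gv.
  by move=> /(_ isT isT).
rewrite /gauge_gap /dual_vector /dist.
case v0: (val v) not_prefix => [|i a] /= => [|npref].
  (* If [v] is the root, its address is a prefix of every other, so [u] must equal [v]. *)
  have [_ _|uv /(_ isT)] := eqVneq u v; last by rewrite prefix0s.
  by rewrite big1 ?addr0// => e _; rewrite ffunE.
rewrite add0r; have [uv|uv] := eqVneq u v; last first.
  rewrite big1// => e eu; rewrite ffunE; case: eqP => // ev.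
  by have := npref uv; rewrite -ev eu.
have ve : val v \in [seq a <- addresses t | a != [::]].
  by rewrite mem_filter v0/= -v0 (valP v).
pose e0 : edge t := SeqSub ve.
have e0v : val e0 = i :: a by rewrite -v0.
rewrite (bigD1 e0) /=; last by rewrite uv prefix_refl.
rewrite ffunE e0v eqxx big1 ?addr0// => e /andP[_ ne].
rewrite ffunE; case: eqP => // ev; case/eqP: ne; apply: val_inj.
by rewrite e0v.
Qed.

(** * Inner product and orthogonality of gradients to tangent spaces *)

Definition inner (R : realType) (t : tree) (x y : ambient R t) : R :=
  x.1 * y.1 + \sum_e x.2 e * y.2 e.

Lemma inner_gradient (R : realType) (t : tree) (v : vertex t)
    (y : ambient R t) :
  inner (gradient R v) y = gauge_gap v y.
Proof.
rewrite /inner /gauge_gap /dist mul1r; congr (_ + _).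
rewrite [RHS]big_mkcond; apply: eq_bigr => e _; rewrite ffunE.
by case: ifP => _; rewrite ?mul1r ?mul0r.
Qed.

Lemma innerC (R : realType) (t : tree) (x y : ambient R t) :
  inner x y = inner y x.
Proof.
by congr (_ + _); [exact: mulrC | apply: eq_bigr => e _; exact: mulrC].
Qed.

Fact inner_is_linear (R : realType) (t : tree) (x : ambient R t) :
  linear (inner x : ambient R t -> R^o).
Proof.
move=> a y z; rewrite /inner /= scalerDr addrACA mulrDr; congr (_ + _ + _).
  by rewrite /GRing.scale/= mulrCA.
by rewrite scaler_sumr -big_split; apply: eq_bigr => e _;
  rewrite !ffunE mulrDr scalerAr.
Qed.

HB.instance Definition _ (R : realType) (t : tree) (x : ambient R t) :=
  GRing.isLinear.Build R (ambient R t) R^o _ (@inner R t x)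
    (@inner_is_linear R t x).

Lemma inner_gt0 (R : realType) (t : tree) (x : ambient R t) :
  (0 < inner x x) = (x != 0).
Proof.
have ge0 : 0 <= inner x x.
  by rewrite addr_ge0 ?sumr_ge0// => *; rewrite -expr2 sqr_ge0.
rewrite lt_neqAle ge0 andbT eq_sym; congr (~~ _).
apply/eqP/eqP => [/eqP|->]; last exact: (raddf0 (inner 0)).
rewrite paddr_eq0 -?expr2 ?sqr_ge0 ?sumr_ge0//; last first.
  by move=> e _; rewrite -expr2 sqr_ge0.
rewrite expf_eq0/= => /andP[/eqP x1 x2]; case: x x1 x2 {ge0} => x1 x2 /= -> s0.
congr (_, _); apply/ffunP => e; rewrite ffunE; move: s0.
rewrite psumr_eq0 => [/allP/(_ e)|]; last by move=> *; rewrite -expr2 sqr_ge0.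
by rewrite mem_index_enum -expr2 expf_eq0 => /(_ isT)/eqP.
Qed.

Definition gauge_gradients (R : realType) (t : tree) (g : gauged t) :
    seq (ambient R t) :=
  [seq gradient R v | v <- gauge_vertices g].

Lemma mem_gauge_vertices (t : tree) (g : gauged t) (v : vertex t) :
  (v \in gauge_vertices g) = (g v == On).
Proof. by rewrite mem_sort mem_enum. Qed.

Lemma uniq_gauge_vertices (t : tree) (g : gauged t) : uniq (gauge_vertices g).
Proof. by rewrite sort_uniq enum_uniq. Qed.

(** Pairing with the gradient of [v] is [gauge_gap v], which vanishes on the tangent space when [v]
    is on the gauge. *)
Lemma inner_span_gradients (R : realType) (t : tree) (g : gauged t)
    (x y : ambient R t) :
  x \in <<gauge_gradients R g>>%VS -> y \in tangent R g -> inner x y = 0.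
Proof.
move=> xX /tangentP ty; suff:
    (<<gauge_gradients R g>> <= lker (linfun (inner y)))%VS.
  by move/subvP/(_ x xX); rewrite memv_ker lfunE /= innerC => /eqP.
apply/span_subvP => z /mapP[v]; rewrite mem_gauge_vertices => gv {z}->.
by rewrite memv_ker lfunE /= innerC inner_gradient ty.
Qed.

(** Pairing with [dual_vector R v] gives 1 on the gradient of [v] and 0 on the other gradients, so
    the first is not in the span of the others. *)
Lemma free_gauge_gradients (R : realType) (t : tree) (g : gauged t) :
  free (gauge_gradients R g).
Proof.
rewrite /gauge_gradients; have := uniq_gauge_vertices g.
have : all (fun v => g v == On) (gauge_vertices g).
  by apply/allP => v; rewrite mem_gauge_vertices.
elim: (gauge_vertices g) => [|v s IH] /=; first by rewrite nil_free.
move=> /andP[gv gs] /andP[vs us]; rewrite free_cons (IH gs us) andbT.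
apply/negP; suff: (<<[seq gradient R u | u <- s]>>
    <= lker (linfun (inner (dual_vector R v))))%VS.
  move/subvP => /[apply]; rewrite memv_ker lfunE /= innerC inner_gradient.
  by rewrite (gauge_gap_dual R gv gv) eqxx oner_eq0.
apply/span_subvP => z /mapP[u us' {z}->].
rewrite memv_ker lfunE /= innerC inner_gradient.
rewrite (gauge_gap_dual R (allP gs _ us') gv).
by have [uv|//] := eqVneq u v; rewrite -uv us' in vs.
Qed.

(** Orthogonality makes the gradients independent of the tangent space, and a dimension count shows
    that together they fill the ambient space. *)
Lemma gauge_gradients_cat_basis (R : realType) (t : tree) (g : gauged t)
    (b : seq (ambient R t)) :
  basis_of (tangent R g) b -> basis_of fullv (gauge_gradients R g ++ b).
Proof.
move=> bb; rewrite basisEfree subvf cat_free.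
rewrite free_gauge_gradients (basis_free bb).
apply/andP; split.
  rewrite directvE /= (span_basis bb); apply/directv_addP/eqP; rewrite -subv0.
  apply/subvP => x; rewrite memv_cap memv0 => /andP[xX xT].
  by have := inner_gt0 x;
    rewrite (inner_span_gradients xX xT) ltxx => /esym/negPn.
(* The dual vectors, as many as the gradients, serve to bound the codimension: subtracting the
   combination [z] with the gaps of [y] as coefficients makes [y] tangent. *)
pose D := [seq dual_vector R v | v <- gauge_vertices g].
have sD : (fullv <= <<D>> + tangent R g)%VS.
  apply/subvP => y _.
  pose z := \sum_(v | g v == On) gauge_gap v y *: dual_vector R v.
  rewrite -(subrK z y) addrC.
  apply: memv_add.
    apply: memv_suml => v gv; apply/memvZ/memv_span/map_f.
    by rewrite mem_gauge_vertices.
  apply/tangentP => v gv; rewrite linearB linear_sum /= (bigD1 v)//=.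
  rewrite linearZ /= (gauge_gap_dual R gv gv) eqxx big1 ?addr0.
    by rewrite [_ *: _]mulr1 subrr.
  move=> u /andP[gu uv].
  by rewrite linearZ /= (gauge_gap_dual R gv gu) eq_sym (negPf uv) scaler0.
apply: leq_trans (dimvS sD) _; apply: leq_trans (dimv_add_leqif _ _) _.
rewrite -(span_basis bb) (eqP (basis_free bb)) size_cat leq_add2r.
by apply: leq_trans (dim_span _) _; rewrite !size_map.
Qed.

(** * Determinants in the coordinates of an ordering *)

Fact coordinates_is_linear (R : realType) (t : tree) (o : ordering t) :
  linear (@coordinates R t o).
Proof.
move=> a x y; apply/rowP => i; rewrite !mxE; case: splitP => j _.
  by rewrite !mxE !ord1 !eqxx !mulr1n.
by rewrite !mxE !ffunE.
Qed.

HB.instance Definition _ (R : realType) (t : tree) (o : ordering t) :=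
  GRing.isLinear.Build R (ambient R t) 'rV[R]_(1 + #|edge t|) _
    (@coordinates R t o) (@coordinates_is_linear R t o).

Lemma coordinates_inj (R : realType) (t : tree) (o : ordering t) :
  injective (@coordinates R t o).
Proof.
apply: raddf_inj => -[l x] /rowP x0.
have oB : bijective (val o).
  by apply: inj_card_bij; [exact/injectiveP/(valP o) | rewrite card_ord].
congr (_, _); first by have := x0 (lshift _ 0); rewrite row_mxEl !mxE eqxx.
apply/ffunP => e; case: oB => o' _ oK.
by have := x0 (rshift _ (o' e)); rewrite row_mxEr !mxE oK ffunE.
Qed.

(** As [coordinates] is linear and injective, a row vector killed by the coordinate matrix is a
    linear relation among the members of [s]. *)
Lemma ordered_det_neq0 (R : realType) (t : tree) (o : ordering t)
    (s : seq (ambient R t)) :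
  basis_of fullv s -> ordered_det o s != 0.
Proof.
move=> sB; have sz : size s = (1 + #|edge t|)%N.
  by rewrite -(dim_ambient R) -(span_basis sB) (eqP (basis_free sB)).
have /freeP sfree : free (tcast sz (in_tuple s)).
  by rewrite val_tcast (basis_free sB).
apply/det0P => -[c /eqP c0]; set M := \matrix_(i < _) _ => cM.
case: c0; apply/rowP => i; rewrite mxE; move: i.
apply: sfree; apply: (@coordinates_inj R t o).
rewrite raddf0 linear_sum /= -[RHS]cM mulmx_sum_row; apply: eq_bigr => i _.
by rewrite linearZ /= rowK val_tcast.
Qed.

(** Cramer's rule: only the coefficient of the replaced vector survives. *)
Lemma ordered_det_replace (R : realType) (t : tree) (o : ordering t)
    (c : 'I_(1 + #|edge t|) -> R) (s1 s2 : seq (ambient R t))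
    (y : ambient R t) (lt_s1 : (size s1 < 1 + #|edge t|)%N) :
  let s := s1 ++ y :: s2 in
  ordered_det o (s1 ++ (\sum_i c i *: s`_i) :: s2) =
    c (Ordinal lt_s1) * ordered_det o s.
Proof.
set k := Ordinal lt_s1 => s; rewrite /ordered_det.
set M := \matrix_(i < _) coordinates o s`_i.
set M' := (X in \det X = _).
have M'k : row k M' = \sum_i c i *: row i M.
  rewrite rowK nth_cat ltnn subnn /= linear_sum; apply: eq_bigr => i _.
  by rewrite rowK linearZ.
have M'i i : i != k -> row i M' = row i M.
  move=> ik; rewrite !rowK !nth_cat; congr coordinates; case: ltnP => // s1i.
  rewrite -[(i - size s1)%N]prednK// subn_gt0 ltn_neqAle s1i andbT.
  by rewrite eq_sym -(inj_eq val_inj) in ik.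
have M'ij i j : i != k -> M' i j = M i j.
  by move=> /M'i/rowP/(_ j); rewrite !mxE.
rewrite (expand_det_row M' k).
(* The cofactors along row [k] do not involve that row, so they are those of [M]; then [M *m \adj M]
   is the scalar matrix of [\det M]. *)
transitivity (((\row_i c i) *m M *m \adj M) 0 k).
  rewrite mxE; apply: eq_bigr => j _; congr (_ * _).
    have /rowP/(_ j) := M'k; rewrite mxE => ->.
    by rewrite summxE mxE; apply: eq_bigr => i _; rewrite !mxE.
  rewrite mxE; congr (_ * \det _); apply/matrixP => i i'.
  by rewrite ![row' _ _ _ _]mxE ![col' _ _ _ _]mxE M'ij// eq_sym neq_lift.
by rewrite -mulmxA mul_mx_adj mul_mx_scalar !mxE mulrC.
Qed.

(** The size bound places both vectors among the rows of the matrix; entries of the list beyond them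
    are ignored. *)
Lemma ordered_det_swap (R : realType) (t : tree) (o : ordering t)
    (s1 s2 : seq (ambient R t)) (x y : ambient R t) :
  ((size s1).+1 < 1 + #|edge t|)%N ->
  ordered_det o (s1 ++ x :: y :: s2) = - ordered_det o (s1 ++ y :: x :: s2).
Proof.
move=> lt_s1; pose k : 'I_(1 + #|edge t|) := Ordinal (ltnW lt_s1).
pose l := Ordinal lt_s1.
have kl : k != l by rewrite -val_eqE /= neq_ltn leqnn.
have detN : \det (tperm_mx k l) = -1 :> R.
  by rewrite det_perm odd_tperm kl expr1.
rewrite -mulN1r -detN -det_mulmx -xrowE; congr (\det _).
apply/matrixP => i j; rewrite [LHS]mxE 2![RHS]mxE; congr (coordinates _ _ _ _).
case: tpermP => [->|->|/eqP ik /eqP il] /=; rewrite !nth_cat.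
- by rewrite ltnn subnn ltnNge leqnSn subSnn.
- by rewrite ltnn subnn ltnNge leqnSn subSnn.
case: ltnP => // s1i; case: (i - size s1)%N (subnK s1i) => [|[|m]] iE //.
  by rewrite -val_eqE /= -iE eqxx in ik.
by rewrite -val_eqE /= -iE eqxx in il.
Qed.

(** The vector [y] passes the members of [s2] one at a time. In the induction the head [x] first
    joins the prefix, and is exchanged with [y] last. *)
Lemma ordered_det_shift (R : realType) (t : tree) (o : ordering t)
    (s1 s2 s3 : seq (ambient R t)) (y : ambient R t) :
  (size s1 + size s2 < 1 + #|edge t|)%N ->
  ordered_det o (s1 ++ s2 ++ y :: s3) =
    (-1) ^+ size s2 * ordered_det o (s1 ++ y :: s2 ++ s3).
Proof.
elim: s2 s1 => [|x s2 IH] s1 /=; first by rewrite mul1r.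
rewrite addnS => lt_s; rewrite -cat_rcons IH ?size_rcons// cat_rcons.
rewrite ordered_det_swap ?exprS ?mulN1r ?mulrN ?mulNr//.
by apply: leq_ltn_trans lt_s; rewrite ltnS leq_addr.
Qed.

(** Reordering the lengths multiplies the coordinate matrix on the right by a permutation matrix, of
    determinant 1 for an even permutation; the block [1%:M] fixes the column of lambda. *)
Lemma ordered_det_same_orientation (R : realType) (t : tree) (o o' : ordering t)
    (s : seq (ambient R t)) :
  same_orientation o o' -> ordered_det o' s = ordered_det o s.
Proof.
case/existsP => p /andP[/negbTE p_even /forallP oo'].
pose P : 'M[R]_(1 + #|edge t|) := block_mx 1%:M 0 0 (perm_mx p^-1).
have detP : \det P = 1.
  by rewrite det_lblock det1 det_perm odd_permV p_even mulr1.
rewrite -[RHS]mulr1 -detP -det_mulmx; congr (\det _); apply/row_matrixP => i.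
rewrite row_mul !rowK mul_row_block !mulmx0 addr0 add0r mulmx1 -col_permE.
congr row_mx; apply/rowP => j; rewrite !mxE; congr (_ _).
exact/eqP/oo'.
Qed.

(** A single representative of the orientation computes the signs for all cells and bases, so the
    two cells can be compared in the same coordinates. *)
Lemma orientation_signE (R : realType) (t : tree) (omega : orientation t) :
  exists o : ordering t, forall (g : gauged t) (b : seq (ambient R t)),
    basis_of (tangent R g) b ->
    orientation_sign g omega b =
      if 0 < ordered_det o (gauge_gradients R g ++ b) then 1 else -1.
Proof.
have [ o omegaE ] := orderingsP omega; exists o => g b bb.
rewrite /orientation_sign /positive_basis bb omegaE /=.
congr (if _ then _ else _).
apply/idP/idP => [/existsP[ o' /andP[]]|o_gt0].
  by rewrite inE => /ordered_det_same_orientation ->.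
apply/existsP; exists o; rewrite o_gt0 andbT inE; apply/existsP; exists 1%g.
by rewrite odd_perm1; apply/forallP => i; rewrite perm1.
Qed.

(** * Left-to-right order of the vertices on the gauge *)

Lemma left_to_right_trans (t : tree) : transitive (@left_to_right t).
Proof. by move=> v u w; exact: le_trans. Qed.

Lemma left_to_right_anti (t : tree) : antisymmetric (@left_to_right t).
Proof. by move=> u v uv; apply/val_inj/(@le_anti _ (seqlexi nat)). Qed.

Lemma left_to_right_total (t : tree) : total (@left_to_right t).
Proof. by move=> u v; exact: (@le_total _ (seqlexi nat)). Qed.

(** Both lists are sorted for a total order and are permutations of each other. *)
Lemma gauge_vertices_stratum (t : tree) (g g0 : gauged t) (v : vertex t)
    (k : nat) :
  gauge_vertex_stratum g g0 v ->
  all (fun u => left_to_right u v) (take k (gauge_vertices g)) ->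
  all (fun u => left_to_right v u) (drop k (gauge_vertices g)) ->
  gauge_vertices g0 =
    take k (gauge_vertices g) ++ v :: drop k (gauge_vertices g).
Proof.
case=> gv g0v g0E vr vl.
have srt (h : gauged t) : sorted (@left_to_right t) (gauge_vertices h).
  exact/sort_sorted/left_to_right_total.
apply: (sorted_eq (@left_to_right_trans t) (@left_to_right_anti t)) => //.
  have := srt g; rewrite -{1}(cat_take_drop k (gauge_vertices g)).
  rewrite !(sorted_pairwise (@left_to_right_trans t)) !pairwise_cat /=.
  move=> /and3P[td -> ->]; rewrite vl !andbT allrel_consr td.
  by rewrite vr.
apply: uniq_perm; rewrite ?uniq_gauge_vertices//.
  rewrite -cat1s uniq_catCA cat_take_drop cons_uniq uniq_gauge_vertices andbT.
  by rewrite mem_gauge_vertices.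
move=> u; rewrite mem_cat inE orbCA -mem_cat cat_take_drop !mem_gauge_vertices.
by have [->|uv] := eqVneq u v; rewrite ?g0v ?eqxx ?g0E.
Qed.

Local Open Scope classical_set_scope.

(** * Half-lines, cells and the compactification *)

Lemma prod_topology_cvg (I T : Type) (K : I -> topologicalType)
    (F : set_system T) (f : T -> prod_topology K) (l : prod_topology K) :
  Filter F -> (forall i, (fun x => f x i) @ F --> l i) -> f @ F --> l.
Proof.
move=> FF fl; apply/cvg_sup => i A [_ [[B oB <-] Bl]] /filterS; apply.
by apply: (fl i); exact: open_nbhs_nbhs.
Qed.

Lemma near_right_affine_gt0 (R : realType) (a b : R) :
  0 < a -> \forall s \near (0 : R)^'+, 0 < a + s * b.
Proof.
(* Adding 1 to the absolute value of [b] keeps the bound meaningful for [b = 0]. *)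
move=> a0; have d0 : 0 < a / (`|b| + 1) by rewrite divr_gt0// ltr_wpDl.
near=> s; have s0 : 0 < s by near: s; exact: nbhs_right_gt.
have : s * (`|b| + 1) < a.
  by rewrite -ltr_pdivlMr ?ltr_wpDl//; near: s; exact: nbhs_right_lt.
rewrite -[b in X in _ -> X]opprK mulrN subr_gt0; apply: le_lt_trans.
apply: ler_wpM2l (ltW s0) _ _ _; rewrite (le_trans (ler_norm _))// normrN.
by rewrite lerDl.
Unshelve. all: by end_near. Qed.

(** The comparison of - lambda with d(r, v) becomes a sign condition on lambda + d(r, v), which is
    affine along half-lines. *)
Definition on_side (R : realType) (p : position) (r : R) : Prop :=
  match p with Below => r < 0 | On => r = 0 | Above => 0 < r end.

Lemma cellP (R : realType) (t : tree) (g : gauged t) (x : ambient R t) :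
  cell g x <->
  (forall e, 0 < x.2 e) /\ (forall v, on_side (g v) (gauge_gap v x)).
Proof.
by split=> -[x0 gx]; split=> // v; move: (gx v); rewrite /on_side /gauge_gap;
  case: (g v); move: (x.1 : R) (dist x v) => l d; lra.
Qed.

Lemma cvg_right_affine_EFin (R : realType) (a b : R) :
  (a + s * b)%:E @[s --> (0 : R)^'+] --> a%:E.
Proof.
apply: cvg_EFin; first exact: nearW.
have : a + s * b @[s --> (0 : R)] --> a + 0 * b.
  exact: cvgD (cvg_cst a) (@mulrr_continuous R b 0).
by rewrite mul0r addr0 => /cvg_at_right_filter.
Qed.

(** Strict inequalities survive small displacements; an equality survives when the direction leaves
    it unchanged. *)
Lemma near_right_on_side (R : realType) (p : position) (a b : R) :
  on_side p a -> (p == On -> b = 0) ->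
  \forall s \near (0 : R)^'+, on_side p (a + s * b).
Proof.
case: p => /= a0 b0.
- have := near_right_affine_gt0 (- b) (eq_ind_r is_true a0 (oppr_gt0 a)).
  by apply: filterS => s; rewrite mulrN -opprD oppr_gt0.
- by rewrite b0//; near=> s; rewrite mulr0 addr0.
- exact: near_right_affine_gt0.
Unshelve. all: by end_near. Qed.

(** Finitely many edges and vertices give finitely many conditions, which hold simultaneously for
    small [s]. *)
Lemma near_right_cell (R : realType) (t : tree) (g : gauged t)
    (x w : ambient R t) :
  (forall e, 0 < x.2 e) ->
  (forall v, \forall s \near (0 : R)^'+,
     on_side (g v) (gauge_gap v x + s * gauge_gap v w)) ->
  \forall s \near (0 : R)^'+, cell g (x + s *: w).
Proof.
move=> x0 gx.
have E := filter_forall _ (fun e => near_right_affine_gt0 (w.2 e) (x0 e)).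
have V := filter_forall _ gx.
near=> s; apply/cellP; split=> [e|v].
  rewrite !ffunE; move: e; near: s; exact: E.
rewrite linearD linearZ /=; move: v; near: s; exact: V.
Unshelve. all: by end_near. Qed.

Lemma cell_near_right (R : realType) (t : tree) (g : gauged t)
    (x w : ambient R t) :
  cell g x -> w \in tangent R g ->
  \forall s \near (0 : R)^'+, cell g (x + s *: w).
Proof.
move=> /cellP[x0 gx] /tangentP tw; apply: near_right_cell => // v.
exact: near_right_on_side (gx v) (tw v).
Qed.

(** The gap of [v] vanishes on the stratum and turns negative along [w]; the other vertices have the
    same position in [g] and [g0]. *)
Lemma stratum_near_right (R : realType) (t : tree) (g g0 : gauged t)
    (v : vertex t) (x w : ambient R t) :
  gauge_vertex_stratum g g0 v -> g v = Below -> cell g0 x ->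
  w \in tangent R g -> gauge_gap v w < 0 ->
  \forall s \near (0 : R)^'+, cell g (x + s *: w).
Proof.
move=> [_ g0v g0E] gv /cellP[x0 gx] /tangentP tw vw.
apply: near_right_cell => // u; have [->|uv] := eqVneq u v.
  have := gx v; rewrite g0v gv /= => ->; near=> s.
  by rewrite add0r pmulr_rlt0//; near: s; exact: nbhs_right_gt.
by apply: near_right_on_side (tw u); rewrite -g0E.
Unshelve. all: by end_near. Qed.

Lemma compactification_near_right (R : realType) (t : tree) (g : gauged t)
    (x w : ambient R t) :
  (\forall s \near (0 : R)^'+, cell g (x + s *: w)) ->
  compactification g (embed x).
Proof.
move=> gx A Ax; have cvgx : embed (x + s *: w) @[s --> (0 : R)^'+] --> embed x.
  apply: prod_topology_cvg => -[e|v] /=.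
    under eq_fun do rewrite !ffunE.
    exact: cvg_right_affine_EFin.
  under eq_fun do rewrite linearD linearZ.
  exact: cvg_right_affine_EFin.
have xA : \forall s \near (0 : R)^'+, A (embed (x + s *: w)) := cvgx A Ax.
have [s [As gs]] := filter_ex (filterI xA gx).
by exists (embed (x + s *: w)); split=> //; exists (x + s *: w).
Qed.

(** The condition that the gap of [v] be positive is open in the product of extended reals and
    misses the cell, so it misses the closure. *)
Lemma compactification_gap_le0 (R : realType) (t : tree) (g : gauged t)
    (v : vertex t) (x : ambient R t) :
  g v = Below -> compactification g (embed x) -> gauge_gap v x <= 0.
Proof.
move=> gv gx; rewrite leNgt; apply/negP => vx.
have vB : nbhs (embed x (inr v)) [set r : \bar R | (0 < r)%E].
  apply: open_nbhs_nbhs; split; last by rewrite /= lte_fin.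
  exact: open_ereal_gt_ereal.
have [_ [[y /cellP[_ /(_ v)] yv <-]]] :=
  gx _ (@proj_continuous _ _ (inr v) (embed x) _ vB).
by rewrite gv /= in yv; rewrite /= /proj /= lte_fin ltNge ltW.
Qed.

(** * Outward-pointing vectors at a stratum *)

Lemma dual_vector_tangent (R : realType) (t : tree) (g g0 : gauged t)
    (v : vertex t) :
  gauge_vertex_stratum g g0 v -> dual_vector R v \in tangent R g.
Proof.
move=> [gv g0v g0E]; apply/tangentP => u gu.
have uv : u != v by apply: contraTneq gu => ->.
by rewrite (gauge_gap_dual R (g := g0)) ?g0v ?g0E// (negPf uv).
Qed.

(** A negative gap leads into the cell and a zero gap along the stratum, both inside the
    compactification; a positive gap leads out of it, and its opposite into the cell. *)
Lemma outward_pointingP (R : realType) (t : tree) (g g0 : gauged t)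
    (v : vertex t) (x w : ambient R t) :
  gauge_vertex_stratum g g0 v -> g v = Below -> cell g0 x ->
  outward_pointing g x w <-> w \in tangent R g /\ 0 < gauge_gap v w.
Proof.
move=> st gv gx; have [_ g0v g0E] := st.
have vx : gauge_gap v x = 0 by have /cellP[_ /(_ v)] := gx; rewrite g0v.
split=> [[tw wout]|[tw vw]]; split=> //.
  rewrite ltNge le_eqVlt; apply/negP => /orP[/eqP vw|vw].
    have tw0 : w \in tangent R g0.
      apply/tangentP => u; have [->//|/g0E ->] := eqVneq u v.
      by move/tangentP: tw; apply.
    have [s [[_]]] := filter_ex (filterI wout (cell_near_right gx tw0)).
    move=> nx gxs; apply: nx.
    (* Points of the stratum are limits of points of the cell: the gap of [v] is -1 along
       [- dual_vector R v]. *)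
    apply: (compactification_near_right (w := - dual_vector R v)).
    apply: (stratum_near_right st gv gxs).
      by rewrite memvN (dual_vector_tangent _ st).
    by rewrite linearN /= (gauge_gap_dual R (g := g0)) ?g0v// eqxx oppr_lt0.
  have gx' := stratum_near_right st gv gx tw vw.
  have [s [[_ nx] gxs]] := filter_ex (filterI wout gx').
  by apply: nx; apply: subset_closure; exists (x + s *: w).
have := stratum_near_right (w := - w) st gv gx.
rewrite memvN linearN /= oppr_lt0 => /(_ tw vw) gxs.
near=> s; split.
  apply: subset_closure; exists (x - s *: w) => //.
  by rewrite -scalerN; near: s; exact: gxs.
move=> /(compactification_gap_le0 gv); apply/negP; rewrite -ltNge.
rewrite linearD linearZ /= vx add0r mulr_gt0//.
Unshelve. all: by end_near. Qed.

(* With q = w - z, orthogonality gives <q, q> = alpha * gauge_gap v w. *)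
Lemma outward_coefficient_gt0 (R : realType) (t : tree) (g g0 : gauged t)
    (v : vertex t) (w y z : ambient R t) (alpha : R) :
  gauge_vertex_stratum g g0 v -> w \in tangent R g -> 0 < gauge_gap v w ->
  y \in <<gauge_gradients R g>>%VS -> z \in tangent R g0 ->
  w = y + alpha *: gradient R v + z -> 0 < alpha.
Proof.
move=> [gv g0v g0E] /tangentP tw vw yX /tangentP tz wE.
pose q := w - z.
have qE : q = y + alpha *: gradient R v by rewrite /q wE addrK.
have tq : q \in tangent R g.
  apply/tangentP => u gu; have uv : u != v by apply: contraTneq gu => ->.
  by rewrite linearB /= tw// tz ?subr0// g0E.
have vq : gauge_gap v q = gauge_gap v w by rewrite linearB /= tz ?subr0// g0v.
have qq : inner q q = alpha * gauge_gap v w.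
  rewrite {2}qE linearD linearZ /= innerC (inner_span_gradients yX tq) add0r.
  by rewrite innerC inner_gradient vq.
(* If [q] were 0, the gap of [w] at [v] would vanish. *)
rewrite -(pmulr_lgt0 _ vw) -qq inner_gt0; apply: contraTneq vw => q0.
by rewrite -vq q0 linear0 ltxx.
Qed.

(** * Comparison of the orientations of the cell and the stratum *)

(** The tangent space of the stratum is the kernel of [gauge_gap v] in that of the cell, and [w]
    lies off this hyperplane. *)
Lemma tangent_cons_basis (R : realType) (t : tree) (g g0 : gauged t)
    (v : vertex t) (w : ambient R t) (b : seq (ambient R t)) :
  gauge_vertex_stratum g g0 v -> w \in tangent R g -> gauge_gap v w != 0 ->
  basis_of (tangent R g0) b -> basis_of (tangent R g) (w :: b).
Proof.
move=> [gv g0v g0E] tw vw bb; rewrite /basis_of free_cons (basis_free bb) andbT.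
rewrite (span_basis bb) span_cons (span_basis bb).
apply/andP; split; last first.
  by apply: contra vw => /tangentP ->//; rewrite g0v.
have t0t : (tangent R g0 <= tangent R g)%VS.
  apply/subvP => y /tangentP ty; apply/tangentP => u gu.
  have uv : u != v by apply: contraTneq gu => ->.
  by rewrite ty// g0E.
rewrite eqEsubv subv_add t0t andbT -memvE tw /=; apply/subvP => y /tangentP ty.
(* With this [a], the vector [y - a *: w] has gap 0 at [v]. *)
pose a := gauge_gap v y / gauge_gap v w.
rewrite -(subrK (a *: w) y) addrC memv_add ?memvZ ?memv_line//.
apply/tangentP => u g0u; rewrite linearB linearZ /=; have [->|uv] := eqVneq u v.
  by rewrite [_ *: _]divfK// subrr.
move/tangentP: tw => tw; rewrite ty ?tw ?scaler0 ?subr0// -?g0E//.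
Qed.

Lemma ordered_det_outward (R : realType) (t : tree) (o : ordering t)
    (g g0 : gauged t) (v : vertex t) (k : nat) (w : ambient R t)
    (b : seq (ambient R t)) :
  gauge_vertex_stratum g g0 v ->
  gauge_vertices g0 =
    take k (gauge_vertices g) ++ v :: drop k (gauge_vertices g) ->
  w \in tangent R g -> 0 < gauge_gap v w -> basis_of (tangent R g0) b ->
  exists2 alpha : R, 0 < alpha &
    ordered_det o (gauge_gradients R g ++ w :: b) =
      alpha * (-1) ^+ size (drop k (gauge_vertices g)) *
      ordered_det o (gauge_gradients R g0 ++ b).
Proof.
move=> st g0E tw vw bb; have fb := gauge_gradients_cat_basis bb.
pose N := (1 + #|edge t|)%N.
have sz : size (gauge_gradients R g0 ++ b) = N.
  by rewrite /N -(dim_ambient R) -(span_basis fb) (eqP (basis_free fb)).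
(* In [s] the gradient of [v] stands exactly where [w] stands in the determinant of the cell. *)
pose X := gauge_gradients R g; pose s := X ++ gradient R v :: b.
have X1 : X = [seq gradient R u | u <- take k (gauge_vertices g)] ++
              [seq gradient R u | u <- drop k (gauge_vertices g)].
  by rewrite -map_cat cat_take_drop.
have sE : ordered_det o s =
    (-1) ^+ size (drop k (gauge_vertices g)) *
    ordered_det o (gauge_gradients R g0 ++ b).
  rewrite /s X1 -catA ordered_det_shift; last first.
    rewrite -/N -sz /gauge_gradients g0E map_cat !size_cat /= -addnA ltn_add2l.
    by rewrite addSn ltnS leq_addr.
  by rewrite size_map /gauge_gradients g0E map_cat -catA.
have perm_s : perm_eq s (gauge_gradients R g0 ++ b).
  rewrite /s X1 /gauge_gradients g0E map_cat /= -!catA.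
  by rewrite perm_cat2l -cat1s perm_catCA.
have szs : size s = N by rewrite (perm_size perm_s).
have lt_X : (size X < N)%N by rewrite -szs size_cat /= addnS ltnS leq_addr.
have ws : w \in << s >>%VS.
  by rewrite (eq_span (perm_mem perm_s)) (span_basis fb) memvf.
have [c wE] : exists c : 'I_N -> R, w = \sum_(i < N) c i *: s`_i.
  rewrite -szs; exists (fun i => coord (in_tuple s) i w).
  exact: (coord_span (X := in_tuple s) ws).
(* Putting [w] in place of the gradient of [v] multiplies the determinant by the coefficient of [w]
   along it. *)
exists (c (Ordinal lt_X)); last by rewrite -mulrA -sE {1}wE ordered_det_replace.
pose m := Ordinal lt_X.
have sm : s`_m = gradient R v by rewrite nth_cat ltnn subnn.
(* The expansion of [w] is split at position [m]: gauge gradients of [g] before it, members of [b]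
   after it. *)
rewrite (bigD1 m)//= sm (bigID (fun i : 'I_N => i < m)%N) /= addrCA addrA in wE.
apply: (outward_coefficient_gt0 st tw vw _ _ wE).
  apply: memv_suml => i /andP[_ im]; apply/memvZ/memv_span.
  by rewrite nth_cat im mem_nth.
rewrite -(span_basis bb); apply: memv_suml => i /andP[im].
rewrite -leqNgt leq_eqVlt => /orP[/eqP mi|mi].
  by rewrite -val_eqE /= -mi eqxx in im.
apply/memvZ/memv_span; rewrite nth_cat ltnNge ltnW//=.
case: (i - size X)%N (subnKC (ltnW mi)) (mi) => [|l] iE; last first.
  move=> _ /=; rewrite mem_nth//.
  have : (i < size s)%N by rewrite szs.
  by rewrite size_cat -iE ltn_add2l ltnS.
by rewrite /= -iE addn0 ltnn.
Qed.

Local Open Scope ring_scope.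

Theorem proposition9 (R : realType) (n : nat) (t : tree) (g g0 : gauged t)
    (omega : orientation t) (j k : nat) (v : vertex t)
    (n_ge2 : (2 <= n)%N) (t_arity : arity t = n) (t_stable : stable t)
    (g_crosses : size (gauge_vertices g) = j)
    (g0_stratum : gauge_vertex_stratum g g0 v)
    (v_below : g v = Below)
    (k_le_j : (k <= j)%N)
    (v_right : all (fun u => left_to_right u v) (take k (gauge_vertices g)))
    (v_left : all (fun u => left_to_right v u) (drop k (gauge_vertices g))) :
  sign_in_boundary R g g0 omega ((-1) ^+ (j + k)).
Proof.
have g0E := gauge_vertices_stratum g0_stratum v_right v_left.
have [ o oE ] := orientation_signE R omega.
move=> x gx; split.
  (* The gap of [v] is 1 along this vector, so it points outward. *)
  exists (dual_vector R v); apply/(outward_pointingP _ g0_stratum v_below gx).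
  split; first exact: dual_vector_tangent g0_stratum.
  have [_ g0v _] := g0_stratum.
  by rewrite (gauge_gap_dual R (g := g0)) ?g0v// eqxx.
move=> w b /(outward_pointingP _ g0_stratum v_below gx)[tw vw] bb.
rewrite !oE//; last first.
  by apply: tangent_cons_basis g0_stratum tw _ bb; rewrite gt_eqF.
have [a a0 ->] := ordered_det_outward o g0_stratum g0E tw vw bb.
(* A zero determinant would get the sign -1 whatever its multiple, so a change of sign is visible
   only for a nonzero one. *)
have := ordered_det_neq0 o (gauge_gradients_cat_basis bb).
rewrite size_drop g_crosses.
(* The gradient of [v] passes [j - k] others, and [j - k] has the parity of [j + k] because
   [k <= j]. *)
have -> : (-1) ^+ (j + k) = (-1) ^+ (j - k) :> int.
  by rewrite -signr_odd -[RHS]signr_odd oddD oddB.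
move: (ordered_det _ _) => d d0.
rewrite -signr_odd -[(-1) ^+ _ in RHS]signr_odd -mulrA pmulr_rgt0//.
case: (odd _); rewrite /= ?expr0 ?mul1r// expr1 !mulN1r oppr_gt0.
by case: ltgtP d0.
Qed.
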